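(* Let $\mathscr{A}=(a_{ijkl})\in\mathbb{T}_{4,3}$ be a paired symmetric tensor, and let $M^1,M^2\in\mathbb{R}^{9\times9}$ be the matrices with entries $$m^1_{3(i-1)+k,\,3(j-1)+l}=a_{ijkl},\qquad m^2_{3(k-1)+i,\,3(l-1)+j}=a_{ijkl},\qquad i,j,k,l\in\{1,2,3\}.$$ Then: (1) the biquadratic form $\mathscr{A}x^2y^2$ is a sum of squares of bilinear forms if $M^1$ is positive semidefinite or $M^2$ is positive semidefinite; furthermore, if $\mathscr{A}$ is an elasticity tensor, then these two conditions are the same. (2) The biquadratic form $\mathscr{A}x^2y^2$ is positive definite if $M^1$ is positive definite or $M^2$ is positive definite; furthermore, if $\mathscr{A}$ is an elasticity tensor, then these two conditions are the same.
   Context: $\mathbb{T}_{4,3}$ is the set of real tensors $\mathscr{A}=(a_{ijkl})$ with $i,j,k,l\in\{1,2,3\}$. $\mathscr{A}$ is paired symmetric if $a_{ijkl}=a_{jikl}=a_{ijlk}=a_{jilk}$ for all indices; it is an elasticity tensor if moreover $a_{ijkl}=a_{klij}$ for all indices. For $x,y\in\mathbb{R}^3$, $\mathscr{A}x^2y^2:=\sum_{i,j,k,l=1}^3a_{ijkl}x_ix_jy_ky_l$; it is positive definite if $\mathscr{A}x^2y^2>0$ for all $x,y\in\mathbb{R}^3\setminus\{0\}$, and a sum of squares of bilinear forms if it equals $\sum_{s=1}^r\big(\sum_{i,j=1}^3\alpha^s_{ij}x_iy_j\big)^2$ identically for some $r\ge1$ and real $\alpha^s_{ij}$. *)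

(* Defs.v *)
From mathcomp Require Import all_boot all_order all_algebra.
From mathcomp Require Import reals.

Set Implicit Arguments.
Unset Strict Implicit.
Unset Printing Implicit Defensive.

Import Order.TTheory GRing.Theory Num.Theory.
Local Open Scope ring_scope.

Definition tensor43 (R : realType) := 'I_3 -> 'I_3 -> 'I_3 -> 'I_3 -> R.

Definition paired_symmetric (R : realType) (a : tensor43 R) : Prop :=
  forall i j k l : 'I_3,
    [/\ a i j k l = a j i k l, a j i k l = a i j l k & a i j l k = a j i l k].

Definition elasticity (R : realType) (a : tensor43 R) : Prop :=
  paired_symmetric a /\ forall i j k l : 'I_3, a i j k l = a k l i j.

Definition biquadratic (R : realType) (a : tensor43 R) (x y : 'rV[R]_3) : R :=
  \sum_(i < 3) \sum_(j < 3) \sum_(k < 3) \sum_(l < 3)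
    a i j k l * x 0 i * x 0 j * y 0 k * y 0 l.

Definition biquadratic_posdef (R : realType) (a : tensor43 R) : Prop :=
  forall x y : 'rV[R]_3, x != 0 -> y != 0 -> 0 < biquadratic a x y.

(* Equality for all real x and y is equality of polynomials, as R is infinite. *)
Definition biquadratic_sos (R : realType) (a : tensor43 R) : Prop :=
  exists r : nat, (1 <= r)%N /\ exists alpha : 'I_r -> 'M[R]_3,
    forall x y : 'rV[R]_3,
      biquadratic a x y =
      \sum_(s < r) (\sum_(i < 3) \sum_(j < 3) alpha s i j * x 0 i * y 0 j) ^+ 2.

Definition psd_mx (R : realType) (n : nat) (M : 'M[R]_n) : Prop :=
  M \is symmetricmx /\ forall v : 'rV[R]_n, 0 <= (v *m M *m v^T) 0 0.

Definition pd_mx (R : realType) (n : nat) (M : 'M[R]_n) : Prop :=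
  M \is symmetricmx /\
  forall v : 'rV[R]_n, v != 0 -> 0 < (v *m M *m v^T) 0 0.

(* The 1-based index 3(p-1)+q becomes 3p+q with 0-based p, q; the next lemma
   shows that inord does not truncate it. *)
Definition pair_index (p q : 'I_3) : 'I_9 := inord (3 * p + q).

Lemma pair_indexE (p q : 'I_3) : pair_index p q = (3 * p + q)%N :> nat.
Proof.
by rewrite inordK //; case: p q => [[|[|[|p]]] ?] [[|[|[|q]]] ?].
Qed.

(* Main.v *)
(** The form at (x, y) is v M v^T, where M = M1 and v is the row with entry
    x_i y_k at the index of (i, k), or M = M2 and the pair is transposed.
    A factorization M = L L^T makes this the sum of the squares of the entries
    of v L, which are bilinear in (x, y); and v is nonzero when x and y are.
    The symmetry a_ijkl = a_klij says precisely that M1 = M2. *)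
Require Import Defs.
From mathcomp Require Import all_boot all_order all_algebra.
From mathcomp Require Import reals.
From mathcomp Require Import zify ring.

Set Implicit Arguments.
Unset Strict Implicit.
Unset Printing Implicit Defensive.

Import Order.TTheory GRing.Theory Num.Theory.
Local Open Scope ring_scope.

Lemma symmetricmxP (R : realType) (n : nat) (M : 'M[R]_n) :
  reflect (M = M^T) (M \is symmetricmx).
Proof.
by apply: (iffP (is_hermitianmxP _ _ M)); rewrite expr0 scale1r map_mx_id.
Qed.

(* With x / 0 = 0 the Schur complement step also covers a zero pivot, whose
   off-diagonal row then vanishes by positive semidefiniteness. *)
Lemma psd_mx_cholesky (R : realType) (n : nat) (M : 'M[R]_n) :
  psd_mx M -> exists L : 'M[R]_n, M = L *m L^T.
Proof.
elim: n M => [|n IHn] M [/symmetricmxP symM psdM].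
  by exists 0; apply/matrixP=> -[].
pose m := M 0 0.
pose b := @ursubmx _ 1 n 1 n M; pose C := @drsubmx _ 1 n 1 n M.
have defM : M = block_mx m%:M b b^T C :> 'M_(1 + n).
  rewrite -[LHS](@submxK _ 1 n 1 n) [ulsubmx _]mx11_scalar trmx_ursub -symM.
  by congr (block_mx _%:M _ _ _); rewrite !mxE !lshift0.
have CT : C^T = C by rewrite trmx_drsub -symM.
clearbody b C.
(* The form of [M] at the row [(t, w)], as a quadratic in [t]; the three claims below come from
   suitable choices of [t]. *)
have formM (t : R) (w : 'rV[R]_n) :
    0 <= t ^+ 2 * m + 2 * t * (w *m b^T) 0 0 + (w *m C *m w^T) 0 0.
  have := psdM (row_mx t%:M w : 'rV_(1 + n)).
  rewrite defM (@mul_row_block _ 1 1 n 1 n) (@tr_row_mx _ 1 1 n).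
  rewrite (@mul_row_col _ 1 1 n 1) tr_scalar_mx !mul_scalar_mx !mul_mx_scalar.
  have : (w *m b^T) 0 0 = (b *m w^T) 0 0.
    by rewrite -[w in LHS]trmxK -trmx_mul [LHS]mxE.
  rewrite mulmxDl -!scalemxAl !mxE eqxx mulr1n => ->.
  by congr (_ <= _); ring.
have m_ge0 : 0 <= m.
  have := formM 1 0.
  by rewrite !mul0mx !mxE mulr0 !addr0 expr1n mul1r.
have b_eq0 : m = 0 -> b = 0.
  move=> m0; apply/rowP=> j; rewrite [RHS]mxE; apply/eqP/contraT => bj.
  pose w : 'rV[R]_n := delta_mx 0 j; pose q := (w *m C *m w^T) 0 0.
  (* For [m = 0] the form is affine in [t] with slope [2 * b 0 j]; this [t] gives it the value
     -1. *)
  have := formM (- (q + 1) / (2 * b 0 j)) w.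
  rewrite m0 mulr0 add0r -/q -rowE !mxE.
  have -> : 2 * (- (q + 1) / (2 * b 0 j)) * b 0 j + q = -1 by field.
  by rewrite oppr_ge0 ler10.
pose s := Num.sqrt m; pose c := s^-1 *: b.
have s2 : s ^+ 2 = m by rewrite sqr_sqrtr.
have bE : b = s *: c.
  have [s0|s0] := eqVneq s 0; last by rewrite scalerA divff ?scale1r.
  by rewrite s0 scale0r b_eq0 // -s2 s0 expr0n.
have [|L defL] := IHn (C - c^T *m c).
  split; first by apply/symmetricmxP; rewrite linearB /= trmx_mul trmxK CT.
  (* For [m > 0] this [t] minimises the quadratic, and the minimum is the form of the Schur
     complement at [w]. For [m = 0] both this [t] and [s^-1] are 0. *)
  move=> w; have := formM (- (w *m b^T) 0 0 / m) w.
  set u := (w *m b^T) 0 0.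
  have -> : w *m (C - c^T *m c) *m w^T = w *m C *m w^T - ((s^-1 * u) ^+ 2)%:M.
    have -> : s^-1 * u = (w *m c^T) 0 0.
      by rewrite /c linearZ /= -scalemxAr [RHS]mxE.
    rewrite mulmxBr mulmxBl mulmxA -(mulmxA (w *m c^T)).
    have -> : c *m w^T = (w *m c^T)^T by rewrite trmx_mul trmxK.
    by rewrite {1 2}[w *m c^T]mx11_scalar tr_scalar_mx -scalar_mxM.
  rewrite [X in _ -> 0 <= X]mxE [(- _%:M) _ _]mxE [_%:M _ _]mxE eqxx mulr1n.
  congr (_ <= _); rewrite -s2 [RHS]addrC; congr (_ + _).
  have [->|s0] := eqVneq s 0; first by rewrite expr0n invr0; ring.
  by field.
(* The blocks of the product are [s ^+ 2 = m], [s *: c = b], its transpose, and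
   [c^T *m c + L *m L^T = C]. *)
exists (block_mx s%:M 0 c^T L : 'M_(1 + n)).
rewrite defM (@tr_block_mx _ 1 n 1 n) (@mulmx_block _ 1 n 1 n 1 n).
rewrite tr_scalar_mx trmx0 trmxK -scalar_mxM -expr2 s2 !mulmx0 !mul0mx !addr0.
rewrite mul_scalar_mx mul_mx_scalar -defL addrC subrK.
by have <- : (s *: c)^T = s *: c^T by [rewrite linearZ]; rewrite -bE.
Qed.

Section Unfolding.

Context (R : realType) (n : nat) (f : 'I_3 -> 'I_3 -> 'I_n).

(** The tensor product of [x] and [y], flattened along [f]. Keeping [f] abstract treats [M1] and
    [M2] at once. *)
Definition tensor_row (x y : 'rV[R]_3) : 'rV[R]_n :=
  \sum_(i < 3) \sum_(k < 3) (x 0 i * y 0 k) *: delta_mx 0 (f i k).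

Lemma tensor_row_mul (p : nat) (L : 'M[R]_(n, p)) (x y : 'rV[R]_3) (s : 'I_p) :
  (tensor_row x y *m L) 0 s =
  \sum_(i < 3) \sum_(k < 3) L (f i k) s * x 0 i * y 0 k.
Proof.
rewrite mulmx_suml summxE; apply: eq_bigr => i _.
rewrite mulmx_suml summxE; apply: eq_bigr => k _.
by rewrite -scalemxAl -rowE !mxE mulrC mulrA.
Qed.

(** Injectivity of [f] keeps products from adding up in one entry, so nonzero [x 0 i] and [y 0 k]
    leave a nonzero entry at [f i k]. *)
Lemma tensor_row_neq0 (x y : 'rV[R]_3) :
  (forall i k i' k', f i k = f i' k' -> i = i' /\ k = k') ->
  x != 0 -> y != 0 -> tensor_row x y != 0.
Proof.
move=> f_inj /rV0Pn[i xi] /rV0Pn[k yk]; apply/rV0Pn; exists (f i k).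
rewrite -[tensor_row x y]mulmx1 tensor_row_mul.
rewrite (bigD1 i) //= (bigD1 k) //= big1 ?addr0 => [|k' k'k].
  rewrite big1 ?addr0 => [|i' i'i].
    by rewrite mxE eqxx mul1r mulf_neq0.
  apply: big1 => k' _; rewrite mxE; case: eqP => [/f_inj[/eqP]|_].
    by rewrite (negPf i'i).
  by rewrite !mul0r.
rewrite mxE; case: eqP => [/f_inj[_ /eqP]|_]; first by rewrite (negPf k'k).
by rewrite !mul0r.
Qed.

Context (a : tensor43 R) (M : 'M[R]_n)
  (M_a : forall i j k l, M (f i k) (f j l) = a i j k l).

Lemma biquadratic_unfold (x y : 'rV[R]_3) :
  biquadratic a x y = (tensor_row x y *m M *m (tensor_row x y)^T) 0 0.
Proof.
rewrite -mulmxA tensor_row_mul; apply: eq_bigr => i _.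
(* The monomial is regrouped as [(x_i y_k) (x_j y_l)]: [(i, k)] indexes the row of [M] and [(j, l)]
   the column. *)
rewrite exchange_big; apply: eq_bigr => k _ /=.
have -> : (M *m (tensor_row x y)^T) (f i k) 0 =
    (tensor_row x y *m M^T) 0 (f i k).
  by rewrite -[M in LHS]trmxK -trmx_mul mxE.
rewrite tensor_row_mul !mulr_suml; apply: eq_bigr => j _.
rewrite !mulr_suml; apply: eq_bigr => l _.
by rewrite mxE M_a; ring.
Qed.

Lemma psd_unfold_sos : (0 < n)%N -> psd_mx M -> biquadratic_sos a.
Proof.
move=> n_gt0 /psd_mx_cholesky[L defM]; exists n; split=> //.
(* Column [s] of [L], folded back into a 3 by 3 matrix along [f], gives the bilinear form number
   [s]. *)
exists (fun s => \matrix_(i, k) L (f i k) s) => x y.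
rewrite biquadratic_unfold defM mulmxA -mulmxA -trmx_mul mxE.
apply: eq_bigr => s _; rewrite [_^T _ _]mxE -expr2 tensor_row_mul.
by congr (_ ^+ 2); apply: eq_bigr => i _; apply: eq_bigr => k _; rewrite mxE.
Qed.

Lemma pd_unfold_posdef :
  (forall i k i' k', f i k = f i' k' -> i = i' /\ k = k') ->
  pd_mx M -> biquadratic_posdef a.
Proof.
move=> f_inj [_ pdM] x y x0 y0.
by rewrite biquadratic_unfold; apply/pdM/tensor_row_neq0.
Qed.

End Unfolding.

Lemma pair_index_inj (i k i' k' : 'I_3) :
  pair_index i k = pair_index i' k' -> i = i' /\ k = k'.
Proof.
move=> /(congr1 val) /=; rewrite !pair_indexE => e.
have := ltn_ord k; have := ltn_ord k' => ? ?.
by split; apply: ord_inj; lia.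
Qed.

Lemma pair_index_surj (p : 'I_9) : exists i k : 'I_3, p = pair_index i k.
Proof.
exists (inord (p %/ 3)), (inord (p %% 3)); apply: ord_inj.
rewrite pair_indexE !inordK ?ltn_pmod // 1?mulnC -?divn_eq //.
by rewrite ltn_divLR // ltn_ord.
Qed.

Theorem theorem5p2 (R : realType) (a : tensor43 R) (M1 M2 : 'M[R]_9)
    (ha : paired_symmetric a)
    (hM1 : forall i j k l : 'I_3,
       M1 (pair_index i k) (pair_index j l) = a i j k l)
    (hM2 : forall i j k l : 'I_3,
       M2 (pair_index k i) (pair_index l j) = a i j k l) :
  ((psd_mx M1 \/ psd_mx M2 -> biquadratic_sos a) /\
   (elasticity a -> (psd_mx M1 <-> psd_mx M2))) /\
  ((pd_mx M1 \/ pd_mx M2 -> biquadratic_posdef a) /\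
   (elasticity a -> (pd_mx M1 <-> pd_mx M2))).
Proof.
(* With [f := swap], [hM2] is the unfolding hypothesis for [M2]. *)
pose swap (i k : 'I_3) := pair_index k i.
have swap_inj i k i' k' : swap i k = swap i' k' -> i = i' /\ k = k'.
  by case/pair_index_inj.
have M12 : elasticity a -> M1 = M2.
  case=> _ a_swap; apply/matrixP=> p q.
  (* At this position [M1] has the entry [a i j k l] and [M2] the entry [a k l i j]. *)
  have [i [k ->]] := pair_index_surj p; have [j [l ->]] := pair_index_surj q.
  by rewrite hM1 hM2.
split; split; try by move=> /M12 ->.
- by case; [apply: (psd_unfold_sos hM1) | apply: (@psd_unfold_sos _ _ swap)].
- case; first exact: (pd_unfold_posdef hM1 pair_index_inj).
  exact: (@pd_unfold_posdef _ _ swap).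
Qed.
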